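(* For $s\in \mathbb{C}$ with $\operatorname{Re}(s)>2$, the zeta function associated to subgroups of $\mathbb{Z}^2$ of finite index, defined as $$\zeta_{\mathbb{Z}^2}(s)=\sum_{n\in \mathbb{N}} \frac{\sum_{d\mid n,\ \frac nd =\square}|\mathbb{PF}^1_d|}{n^s},$$ is given by $$\zeta_{\mathbb{Z}^2}(s)=\zeta(s-1)\zeta(s),\qquad \text{where } \zeta(s)=\sum_{n\in \mathbb{N}}\frac 1{n^s}.$$ Moreover, the zeta function of the one dimensional projective spaces over the integers, defined as $$\zeta_{\mathbb{PF}^1}(s)=\sum_{d\in \mathbb{N}} \frac{|\mathbb{PF}^1_d|}{d^s},$$ satisfies $$\zeta_{\mathbb{Z}^2}(s)=\zeta(2s)\,\zeta_{\mathbb{PF}^1}(s).$$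
   Context: $\mathbb{N}$ denotes the positive integers. For $d\in\mathbb{N}$, $\mathbb{PF}^1_d$ is the quotient of $\{(a,b)\in\mathbb{Z}^2\mid \gcd(a,b)=1\}$ by the equivalence relation $(a,b)\sim(a',b')$ iff $d\mid ab'-ba'$, and $|\mathbb{PF}^1_d|$ is its cardinality. The inner sum runs over positive divisors $d$ of $n$ such that $n/d$ is a perfect square ($\square$). *)

(* Defs.v *)
From HB Require Import structures.
From mathcomp Require Import all_boot all_order all_algebra.
From mathcomp Require Import finmap generic_quotient complex.
From mathcomp Require Import all_classical all_reals all_analysis.
From mathcomp Require Import ring.

Set Implicit Arguments.
Unset Strict Implicit.
Unset Printing Implicit Defensive.

Import Order.TTheory GRing.Theory Num.Theory numFieldNormedType.Exports.

Local Open Scope classical_set_scope.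
Local Open Scope quotient_scope.
Local Open Scope ring_scope.

Definition prim_pair := {x : int * int | coprimez x.1 x.2}.

Section PF1.
Variable d : nat.

Definition pf_rel : rel prim_pair := fun x y =>
  (d %| (val x).1 * (val y).2 - (val x).2 * (val y).1)%Z.

Lemma pf_rel_refl : reflexive pf_rel.
Proof. by move=> x; rewrite /pf_rel [X in _ - X]mulrC subrr dvdz0. Qed.

Lemma pf_rel_sym : symmetric pf_rel.
Proof.
move=> x y; rewrite /pf_rel -[RHS]rpredN opprB.
by rewrite [(val y).1 * _]mulrC [(val y).2 * _]mulrC.
Qed.

Lemma pf_rel_trans : transitive pf_rel.
Proof.
case=> -[a' b'] /= cop [[a b] /= copx] [[a'' b''] /= copz].
rewrite /pf_rel /= => h1 h2; case/coprimezP: cop => -[u v] /= uv.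
have -> : a * b'' - b * a'' =
    u * (a * (a' * b'' - b' * a'') + a'' * (a * b' - b * a'))
    + v * (b * (a' * b'' - b' * a'') + b'' * (a * b' - b * a')).
  by rewrite -[LHS]mul1r -uv; ring.
by apply: rpredD; apply: dvdz_mull; apply: rpredD; apply: dvdz_mull.
Qed.

Canonical pf_equiv := EquivRel pf_rel pf_rel_refl pf_rel_sym pf_rel_trans.

Definition PF1 := {eq_quot pf_equiv}.

(* [fset_set] sends an infinite set to the empty one; this never happens for
   [0 < d], see [finite_PF1]. *)
Definition card_PF1 : nat := #|` fset_set [set: PF1]|.

Lemma finite_PF1 : (0 < d)%N -> finite_set [set: PF1].
Proof.
move=> d0.
have dN0 : (d : int) != 0 by rewrite eqz_nat -lt0n.
have lt_mod (z : int) : (`|(z %% d)%Z| < d)%N.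
  by rewrite -ltz_nat gez0_abs ?modz_ge0 ?ltz_mod.
pose m (z : int) : 'I_d := Ordinal (lt_mod z).
have mE z z' : m z = m z' -> (d %| z - z')%Z.
  move=> /(congr1 val) /= e; rewrite -eqz_mod_dvd; apply/eqP.
  by rewrite -(gez0_abs (modz_ge0 z dN0)) e gez0_abs ?modz_ge0.
pose f (c : PF1) : 'I_d * 'I_d := (m (val (repr c)).1, m (val (repr c)).2).
rewrite -[setT](preimage_setT f); apply: finite_preimage; last first.
  exact: finite_finset.
move=> c c' _ _ ff; have /mE h1 := congr1 fst ff; have /mE h2 := congr1 snd ff.
rewrite -[c]reprK -[c']reprK.
apply/eqquotP; rewrite /= /pf_rel.
set x := val (repr c) in h1 h2 *; set y := val (repr c') in h1 h2 *.
have -> : x.1 * y.2 - x.2 * y.1 = y.2 * (x.1 - y.1) - y.1 * (x.2 - y.2).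
  by ring.
by apply: rpredB; apply: dvdz_mull.
Qed.

End PF1.

Definition is_square (m : nat) : bool := `[< exists k : nat, m = (k ^ 2)%N >].

Definition coef_Z2 (n : nat) : nat :=
  \sum_(e <- divisors n | is_square (n %/ e)) card_PF1 e.

Section Dirichlet.
Variable R : realType.
Local Open Scope complex_scope.

Definition expC (z : R[i]) : R[i] :=
  (expR (complex.Re z))%:C * (cos (complex.Im z) +i* sin (complex.Im z)).

(* n ^ s = exp (s * log n), meaningful for [0 < n] *)
Definition natpowC (n : nat) (s : R[i]) : R[i] := expC (s * (ln n%:R)%:C).

(* The regular algebra R[i]^o is the alias of R[i] carrying the topology of the
   complex modulus. The index is shifted so that the sum starts at n = 1. *)
Definition dirichlet_series (a : nat -> nat) (s : R[i]) : nat -> (R[i])^o :=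
  series (fun k => (a k.+1)%:R / natpowC k.+1 s).

Definition zeta (s : R[i]) : R[i] := limn (dirichlet_series (fun=> 1%N) s).
Definition zeta_Z2 (s : R[i]) : R[i] := limn (dirichlet_series coef_Z2 s).
Definition zeta_PF1 (s : R[i]) : R[i] := limn (dirichlet_series card_PF1 s).

End Dirichlet.

(* Main.v *)
Require Import Defs.
From mathcomp Require Import all_boot all_order all_algebra complex.
From mathcomp Require Import finmap generic_quotient ring lra.
From mathcomp Require Import all_classical all_reals all_analysis.
Import Order.TTheory GRing.Theory Num.Theory numFieldNormedType.Exports.
Local Open Scope classical_set_scope.
Local Open Scope ring_scope.

(* Subgroups of index n in Z^2 correspond to Hermite normal forms, i.e. triples
   (c, a, b) with c * a = n and b < c, of which there are sigma(n). Those of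
   content gcd(a, b, c) = 1 are in bijection with PF^1_n, through
   (c, a, b) |-> class of a primitive pair (a, b') with b' = b mod c; dividing a
   form by its content k turns it into a primitive form of index n / k^2. Hence
   the coefficients of zeta_Z2 are at once the Dirichlet convolution of id and 1
   and the convolution of |PF^1| with the indicator of the squares.
   Both products of series are sums over pairs (i, j), the term of index (i, j)
   contributing to the coefficient i^k * j, with k = 1 and k = 2 respectively.
   The difference between the N-th partial sum of the convolution and the
   product of the N-th partial sums is bounded by the sum of the absolute values
   of the terms with i > M or j > M as soon as M^(k+1) <= N, so it tends to 0.
   Convergence of |PF^1|(n) / n^s follows from |PF^1_n| <= sigma(n). *)

(** * Hermite normal forms, primitive pairs and the coefficients of [zeta_Z2] *)

Section Arithmetic.
Local Open Scope nat_scope.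

(** The Dirichlet convolution at [n] of [g] with [f] carried by the [k]-th powers. For [k > 0],
    contributing pairs have both entries at most [n], so any cutoff [N >= n] gives the same
    value. *)
Definition power_conv (k : nat) (f g : nat -> nat) (N n : nat) : nat :=
  \sum_(i < N) \sum_(j < N | i.+1 ^ k * j.+1 == n) f i.+1 * g j.+1.

Local Notation triple N := ('I_N.+1 * 'I_N.+1 * 'I_N.+1)%type.

(* A Hermite normal form (c, a, b) of index n is stored as ((c, a), b). *)
Definition hermite (N n : nat) : {set triple N} :=
  [set t : triple N | (t.1.1 * t.1.2 == n) && (t.2 < t.1.1)].

Definition content (N : nat) (t : triple N) : nat :=
  gcdn t.1.2 (gcdn t.2 t.1.1).

(** Take for [t] the product of the primes dividing [a] but not [b]: a prime [p] dividing [a]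
    divides exactly one of [b] and [t]. If [p] also divides [b + c * t], it cannot divide [t] alone;
    if it divides [b], it must divide [c], against the gcd condition. *)
Lemma coprime_shift (a b c : nat) : 0 < a ->
  gcdn a (gcdn b c) = 1 -> exists t, coprime a (b + c * t).
Proof.
move=> a0 abc.
exists (\prod_(p <- primes a | ~~ (p %| b)) p).
rewrite /coprime -dvdn1; apply/negPn/negP => h.
set t := \prod_(_ <- _ | _) _ in h.
set g := gcdn _ _ in h.
have g1 : 1 < g.
  have : 0 < g by rewrite gcdn_gt0 a0.
  by move: h; rewrite dvdn1; case: (g) => [|[]].
have pp := pdiv_prime g1; set p := pdiv g in pp.
have pg : p %| g := pdiv_dvd g.
have pa : p %| a by apply: dvdn_trans pg (dvdn_gcdl _ _).
have pbt : p %| b + c * t by apply: dvdn_trans pg (dvdn_gcdr _ _).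
have pt : (p %| t) = ~~ (p %| b).
  rewrite /t Euclid_dvd_prod // big_has_cond; apply/hasP/idP.
    case=> q; rewrite mem_primes => /and3P[qp _ _] /andP[qb].
    by rewrite dvdn_prime2 // => /eqP ->.
  by move=> pb; exists p; [rewrite mem_primes pp a0 pa | rewrite /= pb dvdnn].
case pb: (p %| b); last first.
  have : p %| t by rewrite pt pb.
  by move=> /(dvdn_mull c) pct; move: pbt; rewrite dvdn_addl // pb.
move: pbt; rewrite dvdn_addr // Euclid_dvdM // pt pb orbF => pc.
have : p %| 1 by rewrite -abc !dvdn_gcd pa pb pc.
by rewrite Euclid_dvd1.
Qed.

Lemma hermite_gt0 (N n : nat) (t : triple N) :
  0 < n -> t \in hermite N n -> (0 < t.1.1) && (0 < t.1.2).
Proof. by move=> n0; rewrite inE => /andP[/eqP e _]; rewrite -muln_gt0 e. Qed.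

(** Modulo [a] the determinant is [- y * a'], and [y] is invertible there. Used in both directions,
    this identifies the [a]-entries of two forms with equivalent pairs. *)
Lemma dvdn_of_pf_rel (a a' d : nat) (y y' : int) :
  a %| d -> coprimez a y -> (d %| (a : int) * y' - y * a')%Z%R -> a %| a'.
Proof.
move=> ad cop /(dvdz_trans (ad : (a%:Z %| d%:Z)%Z)).
rewrite rpredBl; last by rewrite dvdz_mulr.
by rewrite Gauss_dvdzr.
Qed.

Lemma card_PF1_hermite (N d : nat) : 0 < d <= N ->
  card_PF1 d = #|[set t in hermite N d | content N t == 1]|.
Proof.
case/andP=> d0 dN.
set P := [set t in _ | _].
(* A primitive lift [(a, b')] with [b'] congruent to [b] modulo [c]; outside [P] the pair [(1, 0)]
   is a dummy value. *)
have shift (t : triple N) : {x : prim_pair |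
    t \in P -> (val x).1 = t.1.2 :> int /\
      ((t.1.1 : nat)%:Z %| ((val x).2 - (t.2 : nat)%:Z)%R)%Z}.
  apply: cid; case: (boolP (t \in P)) => [tP | _]; last first.
    by exists (exist (fun x : int * int => coprimez x.1 x.2) (1, 0)%R isT).
  move: (tP); rewrite inE => /andP[th /eqP /coprime_shift].
  case: (andP (hermite_gt0 _ _ _ d0 th)) => _ a0 /(_ a0)[u].
  move=> cop.
  have copz : coprimez (t.1.2 : nat)%:Z (t.2 + t.1.1 * u)%:Z.
    by rewrite coprimezE.
  exists (exist (fun x : int * int => coprimez x.1 x.2) (_, _) copz) => _ /=.
  split=> //.
  by rewrite PoszD addrC addKr PoszM dvdz_mulr.
pose f t : PF1 d := (\pi_(PF1 d) (sval (shift t)))%qT.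
have finj : {in P &, injective f}.
  move=> t t' tP t'P /eqquotP; rewrite /= /pf_rel.
  case: (shift t) => x /= /(_ tP)[]; case: (shift t') => x' /= /(_ t'P)[].
  case: x => -[x y] /= xy; case: x' => -[x' y'] /= xy'.
  move: tP t'P; rewrite !inE => /andP[/andP[/eqP ca bc] /eqP _].
  move=> /andP[/andP[/eqP ca' bc'] /eqP _] ex' hy' ex hy hd.
  rewrite /= {}ex' in xy' hd; rewrite /= {}ex in xy hd.
  have e : t.1.2 = t'.1.2.
    apply/val_inj/eqP; rewrite eqn_dvd /=; apply/andP; split.
      by apply: dvdn_of_pf_rel hd; rewrite // -ca dvdn_mull.
    apply: (@dvdn_of_pf_rel _ _ d y' y) => //; first by rewrite -ca' dvdn_mull.
    by rewrite -rpredN opprB [(_ * y)%R]mulrC [(y' * _)%R]mulrC.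
  have a0 : 0 < t.1.2 by move: d0; rewrite -ca muln_gt0 => /andP[].
  have c_eq : t.1.1 = t'.1.1.
    apply/val_inj/eqP; rewrite -(eqn_pmul2r a0) /= ca -ca' e //.
  (* Once [a] and [c] agree, [d = c * a] divides [a * (y' - y)], so [c] divides [y' - y] and hence
     [t'.2 - t.2]; both residues lie below [c]. *)
  move: hd; rewrite -e [(y * _)%R]mulrC -mulrBr -ca mulnC PoszM dvdz_mul2l;
    last first.
    by rewrite eqz_nat -lt0n.
  rewrite -c_eq in hy' bc' => hd.
  have hb : ((t.1.1 : nat)%:Z %| ((t'.2 : nat)%:Z - (t.2 : nat)%:Z)%R)%Z.
    have -> : ((t'.2 : nat)%:Z - (t.2 : nat)%:Z = (y' - y) + (y - (t.2 : nat)%:Z)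
      - (y' - (t'.2 : nat)%:Z))%R by ring.
    by rewrite rpredB // rpredD.
  have b_eq : t.2 = t'.2.
    apply/val_inj/esym => /=.
    move: hb; rewrite -eqz_mod_dvd => /eqP.
    by rewrite !modz_small ?lez_nat ?ltz_nat /= ; try by []; case.
  by move: e c_eq b_eq; case: (t) (t') => [[? ?] ?] [[? ?] ?] /= -> -> ->.
have -> : card_PF1 d = #|` [fset f x | x in P]%fset|.
  congr (#|` _ |); apply/fsetP => c; rewrite in_fset_set;
    last exact: finite_PF1.
  rewrite in_setT; apply/esym/imfsetP.
  case exy: (repr c) => [[x y] /= xy].
  have dN0 : d%:Z != 0%R by rewrite eqz_nat -lt0n.
  (* A preimage of the class of [(x, y)]: [a = gcd(x, d)], [c = q = d / a] and [b = y * u] modulo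
     [q], where [u] inverts [x' = x / a] modulo [q]. Then [y] is congruent to [b * x'] modulo
     [q]. *)
  pose a := gcdn `|x| d; pose q := d %/ a.
  have a0 : 0 < a by rewrite gcdn_gt0 d0 orbT.
  have qa : q * a = d by rewrite divnK // dvdn_gcdr.
  have q0 : 0 < q by move: d0; rewrite -qa muln_gt0 => /andP[].
  have /dvdzP[x' xE] : (a%:Z %| x)%Z by exact: dvdn_gcdl.
  have /coprimezP[[u v] /= uv] : coprimez x' q.
    rewrite coprimezE /coprime -(eqn_pmul2r a0) mul1n muln_gcdl.
    by rewrite absz_nat qa -[X in _ * X]absz_nat -abszM -xE.
  pose b := `|(y * u)%R %% q|%Z.
  have bE : b = ((y * u)%R %% q)%Z :> int.
    by rewrite gez0_abs ?modz_ge0 // eqz_nat -lt0n.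
  have bq : b < q by rewrite -ltz_nat bE ltz_pmod.
  have ybx : (q%:Z %| (y - b%:Z * x')%R)%Z.
    have -> : (y - b%:Z * x' = y * v * q%:Z + (y * u - b%:Z) * x')%R.
      by rewrite -[in LHS](mulr1 y) -uv; ring.
    apply: rpredD; [exact: dvdz_mull | apply: dvdz_mulr; rewrite bE].
    by rewrite -eqz_mod_dvd modz_mod.
  have lt_d m : m %| d -> m < N.+1.
    by move=> /(dvdn_leq d0) /leq_trans; apply.
  pose t : triple N := (inord q, inord a, inord b).
  have tq : t.1.1 = q :> nat by rewrite inordK // lt_d // -qa dvdn_mulr.
  have ta : t.1.2 = a :> nat by rewrite inordK // lt_d // -qa dvdn_mull.
  have tb : t.2 = b :> nat.
    by rewrite inordK // (ltn_trans bq) // lt_d // -qa dvdn_mulr.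
  have tP : t \in P.
    rewrite !inE tq ta tb qa eqxx bq /content tq ta tb /= -dvdn1.
    set g := gcdn a _.
    have [ga gb gq] : [/\ g %| a, g %| b & g %| q].
      by move: (dvdnn g); rewrite {2}/g !dvdn_gcd => /and3P[].
    (* The content divides [a], hence [x]; it divides [b] and [q], hence [y]. But [(x, y)] is
       primitive. *)
    have : g %| gcdn `|x| `|y|.
      rewrite dvdn_gcd (dvdn_trans ga (dvdn_gcdl _ _)) /=.
      rewrite -[g]absz_nat -dvdzE -[y](subrK (b%:Z * x')%R).
      by apply: rpredD; [exact: dvdz_trans ybx | exact: dvdz_mulr].
    by move: (xy); rewrite coprimezE /coprime => /eqP ->.
  exists t => //; rewrite /f; case: (shift t) => z /= /(_ tP) [].
  case: z => [[x1 y1] /= xy1] x1E y1b.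
  rewrite -[c]reprK exy; apply/eqquotP; rewrite /= /pf_rel /=.
  rewrite x1E ta -qa PoszM xE.
  have -> : (x' * a%:Z * y1 - y * a%:Z =
      (x' * (y1 - b%:Z) - (y - b%:Z * x')) * a%:Z)%R by ring.
  by rewrite dvdz_mul2r ?eqz_nat -?lt0n // rpredB // dvdz_mull // -tq -tb.
by rewrite card_in_imfset //= -cardE.
Qed.

(** Each factorization [n = c * a] leaves [c] choices for [b]. *)
Lemma card_hermite (N n : nat) : 0 < n ->
  #|hermite N n| = power_conv 1 id (fun=> 1) N n.
Proof.
move=> n0; rewrite -sum1_card.
transitivity (\sum_(p : 'I_N.+1 * 'I_N.+1 | p.1 * p.2 == n) p.1).
  transitivity (\sum_(p : 'I_N.+1 * 'I_N.+1 | p.1 * p.2 == n)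
      \sum_(b < N.+1 | b < p.1) 1).
    by rewrite pair_big_dep; apply: eq_bigl => t; rewrite inE.
  apply: eq_bigr => p _; rewrite -(big_ord_widen _ (fun=> 1)) ?sum_nat_const
    ?card_ord ?muln1 //.
  exact/ltnW/ltn_ord.
rewrite -(pair_big_dep predT (fun c a : 'I_N.+1 => c * a == n)
  (fun c a : 'I_N.+1 => c : nat)) /=.
(* Entries start at 0: [c = 0] adds nothing, and [a = 0] is excluded by [n > 0]. *)
rewrite big_ord_recl [X in X + _]big1 // add0n; apply: eq_bigr => i _.
rewrite big_mkcond big_ord_recl muln0 ltn_eqF //= add0n -big_mkcond.
by apply: eq_big => j; rewrite ?muln1.
Qed.

(** Multiplying all entries by [k] multiplies the index by [k ^ 2] and the content by [k], and
    preserves [b < c]. On primitive forms of index [m] this is a bijection, inverted by division by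
    [k]. *)
Lemma card_hermite_content (N k m : nat) : 0 < k -> 0 < m -> k ^ 2 * m <= N ->
  #|[set t in hermite N (k ^ 2 * m) | content N t == k]| = card_PF1 m.
Proof.
move=> k0 m0 kmN.
have mN : 0 < m <= N.
  by rewrite m0 (leq_trans _ kmN) // leq_pmull // expn_gt0 k0.
rewrite (card_PF1_hermite N) //.
pose sc (t : triple N) : triple N :=
  (inord (k * t.1.1), inord (k * t.1.2), inord (k * t.2)).
set P := [set t in hermite N m | _].
have lt_kN x : x <= m -> k * x < N.+1.
  by move=> xm; rewrite ltnS (leq_trans _ kmN) // leq_mul // -{1}[k]muln1
    leq_mul2l k0 orbT.
have scE t : t \in P -> [/\ (sc t).1.1 = k * t.1.1 :> nat,
    (sc t).1.2 = k * t.1.2 :> nat & (sc t).2 = k * t.2 :> nat].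
  rewrite inE => /andP[th _]; have /andP[c0 a0] := hermite_gt0 _ _ _ m0 th.
  move: th; rewrite inE => /andP[/eqP ca bc].
  split; rewrite /= inordK // lt_kN // -ca ?leq_pmulr ?leq_pmull //.
  by rewrite (leq_trans (ltnW bc)) // leq_pmulr.
rewrite -(@card_in_imset _ _ sc P); last first.
  move=> t t' /scE[h1 h2 h3] /scE[h1' h2' h3'] e.
  rewrite {}e h1' h2' h3' in h1 h2 h3.
  move: h1 h2 h3; case: (t) (t') => [[c a] b] [[c' a'] b'] /=.
  by do 3![move=> /eqP; rewrite eqn_pmul2l // => /eqP/val_inj ->].
apply: eq_card => t; rewrite !inE; apply/idP/imsetP; last first.
  move=> [t' t'P ->]; have [h1 h2 h3] := scE _ t'P.
  rewrite /content h1 h2 h3 -!muln_gcdr.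
  move: t'P; rewrite !inE => /andP[/andP[/eqP <- bc] /eqP].
  by rewrite /content => ->;
    rewrite muln1 eqxx ltn_pmul2l // bc mulnACA mulnn eqxx.
move=> /andP[/andP[/eqP ca bc] /eqP tk].
have [ka kb kc] : [/\ k %| t.1.2, k %| t.2 & k %| t.1.1].
  by move: (dvdnn k); rewrite -{2}tk !dvdn_gcd => /and3P[].
have lt_N (x : 'I_N.+1) : x %/ k < N.+1.
  by rewrite (leq_ltn_trans (leq_div _ _)).
pose t' : triple N := (inord (t.1.1 %/ k), inord (t.1.2 %/ k),
  inord (t.2 %/ k)).
have t'P : t' \in P.
  rewrite !inE /content !inordK //; apply/andP; split; last first.
    rewrite -(@eqn_pmul2l k) // muln1 !muln_gcdr ![k * (_ %/ _)]mulnC !divnK //.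
    exact/eqP.
  rewrite -(@ltn_pmul2r k) // !divnK // bc andbT.
  rewrite -(@eqn_pmul2l (k ^ 2)) ?expn_gt0 ?k0 // -ca.
  by rewrite -mulnn mulnACA ![k * (_ %/ _)]mulnC !divnK.
exists t' => //; have [h1 h2 h3] := scE _ t'P.
have t'E (x : 'I_N.+1) : k %| x -> k * (inord (x %/ k) : 'I_N.+1) = x.
  by move=> kx; rewrite inordK // mulnC divnK.
move: h1 h2 h3; rewrite !t'E //.
case: (sc t') => [[c' a'] b']; case: (t) => [[c a] b] /=.
by move=> /val_inj -> /val_inj -> /val_inj ->.
Qed.

Lemma card_hermite_PF1 (N n : nat) : 0 < n <= N ->
  #|hermite N n| = power_conv 2 (fun=> 1) (@card_PF1) N n.
Proof.
case/andP=> n0 nN; rewrite -sum1_card.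
transitivity (\sum_(t in hermite N n) \sum_(i < N | content N t == i.+1) 1).
  apply: eq_bigr => t th.
  have /andP[c0 a0] := hermite_gt0 _ _ _ n0 th.
  have g0 : 0 < content N t by rewrite gcdn_gt0 a0.
  (* The content divides [a], hence [n], so it falls within the cutoff. *)
  have gN : (content N t).-1 < N.
    rewrite prednK //; apply: leq_trans nN; apply: dvdn_leq => //.
    move: th; rewrite inE => /andP[/eqP <- _]; apply: dvdn_mull;
      exact: dvdn_gcdl.
  by rewrite (big_pred1 (Ordinal gN)) // => i;
    rewrite -[RHS]val_eqE -[RHS]eqSS /= prednK // eq_sym.
rewrite (exchange_big_dep predT) //=; apply: eq_bigr => i _.
rewrite sum1_card.
(* A content [k] divides both [c] and [a], so [k ^ 2] divides [n]; if it does not, both sides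
   vanish. *)
have [/dvdnP[m nE] | ndvd] := boolP (i.+1 ^ 2 %| n); last first.
  rewrite big1; last first.
    by move=> j /eqP e; move: ndvd; rewrite -e dvdn_mulr.
  apply: eq_card0 => t; rewrite unfold_in /= inE.
  apply/negbTE/negP => /andP[/andP[/eqP e _] /eqP c].
  move/negP: ndvd; apply; rewrite -e mulnC -[_ ^ 2]/(i.+1 * i.+1) dvdn_mul //.
    by rewrite -c dvdn_gcdl.
  by rewrite -c /content gcdnA dvdn_gcdr.
have m0 : 0 < m by move: n0; rewrite nE muln_gt0 => /andP[].
have mN : m.-1 < N.
  by rewrite prednK // (leq_trans _ nN) // nE leq_pmulr // expn_gt0.
rewrite (big_pred1 (Ordinal mN)); last first.
  by move=> j; rewrite nE mulnC eqn_pmul2r ?expn_gt0 // -[RHS]val_eqE /=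
    -[RHS]eqSS prednK.
rewrite /= prednK // mul1n -(card_hermite_content N i.+1 m) //;
  last by rewrite mulnC -nE.
by apply: eq_card => t; rewrite [LHS]unfold_in /= [RHS]inE mulnC -nE.
Qed.

(** A positive square has a single positive root, so pairs [(k, d)] with [k ^ 2 * d = n] correspond
    to divisors [d] of [n] with square cofactor. *)
Lemma coef_Z2_conv (N n : nat) : 0 < n <= N ->
  coef_Z2 n = power_conv 2 (fun=> 1) (@card_PF1) N n.
Proof.
case/andP=> n0 nN; rewrite /coef_Z2 /power_conv.
have /(perm_big _) -> : perm_eq (divisors n)
    [seq e <- index_iota 1 N.+1 | e %| n].
  apply: uniq_perm; rewrite ?divisors_uniq ?filter_uniq ?iota_uniq // => e.
  rewrite mem_filter mem_index_iota -dvdn_divisors //.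
  case: (boolP (e %| n)) => //= en.
  by rewrite (dvdn_gt0 n0 en) ltnS (leq_trans (dvdn_leq n0 en)).
rewrite big_filter_cond big_add1 /= big_mkord (exchange_big_dep predT) //=.
rewrite big_mkcond; apply: eq_bigr => j _.
have [/dvdnP[m nE] | ndvd] := boolP (j.+1 %| n); last first.
  by rewrite big1 // => i /eqP e; move: ndvd; rewrite -e dvdn_mull.
rewrite nE mulnK //=; case: (boolP (is_square m)) =>
  [/asboolP[k mE] | /asboolPn nsq]; last first.
  by rewrite big1 // => i; rewrite eqn_pmul2r // => /eqP e; case: nsq;
    exists i.+1.
have k0 : 0 < k by move: n0; rewrite nE mE muln_gt0 expn_gt0 orbF => /andP[].
have kN : k.-1 < N.
  rewrite prednK // (leq_trans _ nN) // nE mE -mulnn -mulnA leq_pmulr //.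
  by rewrite muln_gt0 k0.
rewrite (big_pred1 (Ordinal kN)) ?mul1n // => i.
by rewrite mE eqn_pmul2r // eqn_exp2r // -[RHS]val_eqE -[RHS]eqSS /= prednK.
Qed.

Lemma coef_Z2_sigma (N n : nat) : 0 < n <= N ->
  coef_Z2 n = power_conv 1 id (fun=> 1) N n.
Proof.
move=> nN; rewrite (coef_Z2_conv _ _ nN) -card_hermite_PF1 // card_hermite //.
by case/andP: nN.
Qed.

(** [n] is itself an admissible divisor, its cofactor 1 being a square. *)
Lemma leq_card_PF1_coef_Z2 (n : nat) : 0 < n -> card_PF1 n <= coef_Z2 n.
Proof.
move=> n0; rewrite /coef_Z2 big_mkcond (bigD1_seq n) ?divisors_uniq
  ?divisors_id //=.
rewrite divnn n0 ifT ?leq_addr //; apply/asboolP.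
by exists 1.
Qed.

End Arithmetic.

(** * Partial sums of a convolution against products of partial sums *)

Section PowerConvolution.
Context {K : numDomainType} (k : nat) (a b c : nat -> K).
Hypothesis cE : forall N n, (n < N)%N ->
  c n = \sum_(i < N) \sum_(j < N | (i.+1 ^ k * j.+1 == n.+1)%N) a i * b j.

(** A pair with [i.+1 ^ k * j.+1 <= N] occurs for exactly one [n], that value minus one; other pairs
    never occur. *)
Lemma sum_power_conv (N : nat) : \sum_(n < N) c n =
  \sum_(i < N) \sum_(j < N | (i.+1 ^ k * j.+1 <= N)%N) a i * b j.
Proof.
under eq_bigr => n _ do rewrite (cE N n (ltn_ord n)).
rewrite exchange_big; apply: eq_bigr => i _ /=.
rewrite (exchange_big_dep (fun j : 'I_N => (i.+1 ^ k * j.+1 <= N)%N)) /=;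
  last first.
  by move=> n j _ /eqP ->.
apply: eq_bigr => j le_N.
have gt0 : (0 < i.+1 ^ k * j.+1)%N by rewrite muln_gt0 expn_gt0.
have lt_N : ((i.+1 ^ k * j.+1).-1 < N)%N by rewrite prednK.
rewrite (big_pred1 (Ordinal lt_N)) // => n.
by rewrite -[RHS]val_eqE -[RHS]eqSS /= prednK // eq_sym.
Qed.

Lemma norm_sum_power_conv (M N : nat) : (M ^ k.+1 <= N)%N ->
  `|\sum_(n < N) c n - (\sum_(i < N) a i) * (\sum_(j < N) b j)| <=
  (\sum_(i < N) `|a i|) * (\sum_(j < N) `|b j|)
  - (\sum_(i < M) `|a i|) * (\sum_(j < M) `|b j|).
Proof.
move=> MkN.
have MN : (M <= N)%N.
  by apply: leq_trans MkN; case: (M) => // M';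
    rewrite expnS leq_pmulr // expn_gt0.
rewrite sum_power_conv.
have prod_sum n (u v : nat -> K) : (\sum_(i < n) u i) * (\sum_(j < n) v j) =
    \sum_(p : 'I_n * 'I_n) u p.1 * v p.2.
  by rewrite big_distrlr /= pair_big.
rewrite pair_big_dep /= (prod_sum _ a b) [X in _ - X](bigID
  (fun p : 'I_N * 'I_N => (p.1.+1 ^ k * p.2.+1 <= N)%N)) /=.
(* Only the pairs with [i.+1 ^ k * j.+1 > N] survive. *)
rewrite opprD addrA subrr sub0r normrN.
apply: le_trans (ler_norm_sum _ _ _) _.
under [leLHS]eq_bigr => p _ do rewrite normrM.
rewrite (prod_sum N (fun i => `|a i|) (fun j => `|b j|)).
have -> : (\sum_(i < M) `|a i|) * (\sum_(j < M) `|b j|) =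
    \sum_(p : 'I_N * 'I_N | (p.1 < M)%N && (p.2 < M)%N) `|a p.1| * `|b p.2|.
  rewrite (big_ord_widen _ (fun i => `|a i|) MN)
    (big_ord_widen _ (fun j => `|b j|) MN).
  by rewrite big_distrlr /= pair_big.
rewrite [X in _ <= X - _](bigID (fun p : 'I_N * 'I_N =>
  (p.1 < M)%N && (p.2 < M)%N)) /=.
rewrite [leRHS]addrC addKr.
rewrite big_mkcond [leRHS]big_mkcond; apply: ler_sum => p _.
case: ifPn => h; last by case: ifPn => // _; rewrite mulr_ge0.
(* A surviving pair cannot have both indices below [M], since then
   [i.+1 ^ k * j.+1 <= M ^ k.+1 <= N]. *)
rewrite ifT //; apply: contra h => /andP[p1 p2].
apply: leq_trans MkN; rewrite expnSr leq_mul //.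
by case: (posnP k) => [->|k0]; rewrite ?expn0 ?leq_exp2r.
Qed.

End PowerConvolution.

(** * Absolutely convergent complex series *)

Section ComplexSeries.
Context {R : realType}.
Local Open Scope complex_scope.

(** The topology quantifies over [e] in [R[i]], where [0 < e] forces [e] to be real; so real bounds
    suffice. *)
Lemma cvgn_complex (z : nat -> R[i]^o) (l : R[i]^o) :
  (forall e : R, 0 < e -> \forall n \near \oo, `|z n - l| <= e%:C) ->
  z @ \oo --> l.
Proof.
move=> h; apply/cvgrPdist_le => e e0.
move: e0; rewrite ltcE /= => /andP[/eqP im0 re0].
have [N _ hN] := h _ re0.
exists N => // n /hN; rewrite distrC => /le_trans; apply.
by rewrite lecE /= im0 eqxx lexx.
Qed.

Lemma normc_le (x y : R) : `|x +i* y| <= (`|x| + `|y|)%:C.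
Proof.
have -> : x +i* y = x%:C + 'i * y%:C by rewrite {1}[x +i* y]complexE.
apply: le_trans (ler_normD _ _) _; rewrite rmorphD /= normrM.
have nR (t : R) : `|t%:C| = `|t|%:C.
  by rewrite normc_def /= expr0n addr0 sqrtr_sqr.
by rewrite !nR (_ : `|'i| = 1) ?mul1r // normc_def /= expr0n expr1n add0r
  sqrtr1.
Qed.

Lemma normc_ge_Re_Im (x y r : R) : `|x +i* y| <= r%:C -> `|x| <= r /\ `|y| <= r.
Proof.
rewrite normc_def lecR /= => h.
by split; apply: le_trans h;
  rewrite -sqrtr_sqr ler_wsqrtr // ?lerDl ?lerDr sqr_ge0.
Qed.

Lemma cvgn_bounded_sum (u : R^nat) (M : R) : (forall i, 0 <= u i) ->
  (forall N, \sum_(i < N) u i <= M) -> cvgn (series u).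
Proof.
move=> u0 uM; apply: nondecreasing_is_cvgn.
  by apply: nondecreasing_series => i _ _.
by exists M => _ [N _ <-]; rewrite /series /= big_mkord.
Qed.

(** Real and imaginary parts form real series dominated by [u], and their limits make up the complex
    one. *)
Lemma cvgn_complex_series (z : nat -> R[i]^o) (u : R^nat) (M : R) :
  (forall i, `|z i| = (u i)%:C) ->
  (forall N, \sum_(i < N) u i <= M) -> cvgn (series z).
Proof.
move=> zu uM.
have u0 i : 0 <= u i by rewrite -ler0c -zu.
have cu := cvgn_bounded_sum _ _ u0 uM.
have hRI i := normc_ge_Re_Im (complex.Re (z i)) (complex.Im (z i)) (u i).
have hz i : `|complex.Re (z i)| <= u i /\ `|complex.Im (z i)| <= u i.
  by apply: hRI; move: (zu i); case: (z i) => x y /= ->.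
have cRe : cvgn (series (fun i => complex.Re (z i))).
  apply: normed_cvg; apply: (series_le_cvg _ u0 _ cu) => i;
    [exact: normr_ge0 | exact: (hz i).1].
have cIm : cvgn (series (fun i => complex.Im (z i))).
  apply: normed_cvg; apply: (series_le_cvg _ u0 _ cu) => i;
    [exact: normr_ge0 | exact: (hz i).2].
have serE n : series z n = series (fun i => complex.Re (z i)) n +i*
                           series (fun i => complex.Im (z i)) n.
  rewrite /series /=; elim: n => [|n IH]; first by rewrite !big_geq.
  by rewrite !big_nat_recr //= IH; case: (z n).
apply/cvg_ex; exists (limn (series (fun i => complex.Re (z i))) +i*
                      limn (series (fun i => complex.Im (z i)))).
apply: cvgn_complex => e e0.
have e20 : 0 < e / 2 by rewrite divr_gt0.
have /cvgrPdist_le/(_ _ e20) h1 := cRe.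
have /cvgrPdist_le/(_ _ e20) h2 := cIm.
near=> n; rewrite serE.
apply: le_trans (normc_le _ _) _; rewrite lecR [e]splitr.
apply: lerD; rewrite distrC; near: n.
  exact: h1.
exact: h2.
Unshelve. all: by end_near.
Qed.

Lemma cvgn_power_conv (k : nat) (a b c : nat -> R[i]^o) (u v : R^nat)
    (A B : R) :
  (forall N n, (n < N)%N ->
   c n = \sum_(i < N) \sum_(j < N | (i.+1 ^ k * j.+1 == n.+1)%N) a i * b j) ->
  (forall i, `|a i| = (u i)%:C) -> (forall N, \sum_(i < N) u i <= A) ->
  (forall j, `|b j| = (v j)%:C) -> (forall N, \sum_(j < N) v j <= B) ->
  series c @ \oo --> (limn (series a) * limn (series b) : R[i]^o).
Proof.
move=> cE au uA bv vB.
have ca := cvgn_complex_series _ _ _ au uA.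
have cb := cvgn_complex_series _ _ _ bv vB.
have u0 i : 0 <= u i by rewrite -ler0c -au.
have v0 i : 0 <= v i by rewrite -ler0c -bv.
have cu := cvgn_bounded_sum _ _ u0 uA.
have cv := cvgn_bounded_sum _ _ v0 vB.
have cuv : series u \* series v @ \oo --> limn (series u) * limn (series v).
  exact: cvgM.
have nd_uv m n : (m <= n)%N ->
  series u m * series v m <= series u n * series v n.
  move=> mn; apply: ler_pM; rewrite ?sumr_ge0 //.
  - by apply: nondecreasing_series mn => i _ _.
  - by apply: nondecreasing_series mn => i _ _.
have diff0 :
    (fun n => series c n - series a n * series b n) @ \oo --> (0 : R[i]^o).
  apply: cvgn_complex => e e0.
  (* [M] puts the product of the partial sums of [u] and [v] within [e] of its limit. For
     [N >= M ^ k.+1] the error is at most the growth of that product from [M] to [N], which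
     monotonicity bounds by [e]. *)
  have /cvgrPdist_le/(_ _ e0)[M _ hM] := cuv.
  exists (M ^ k.+1)%N => // N /= MN; rewrite subr0.
  rewrite /series /= !big_mkord.
  apply: le_trans (norm_sum_power_conv k a b c cE M N MN) _.
  have sumC (w : R^nat) (d : nat -> R[i]) n : (forall i, `|d i| = (w i)%:C) ->
      \sum_(i < n) `|d i| = (series w n)%:C.
    move=> dw; rewrite /series /= big_mkord rmorph_sum /=.
    by apply: eq_bigr => i _; rewrite dw.
  rewrite !(sumC u a) // !(sumC v b) // -!rmorphM -rmorphB lecR.
  have /= le_lim := nondecreasing_cvgn_le nd_uv (cvgP _ cuv) N.
  rewrite (cvg_lim _ cuv) // in le_lim.
  rewrite lerBlDl; apply: le_trans le_lim _.
  by have := hM M (leqnn M); rewrite ler_distl => /andP[].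
have cab : (fun n => series a n * series b n) @ \oo -->
    (limn (series a) * limn (series b) : R[i]^o).
  exact: (@cvgM (R[i]) _ _ _ (series a) (series b) _ _ ca cb).
have := cvgD (FF := eventually_filter) diff0 cab; rewrite add0r.
have -> : (fun n => series c n - series a n * series b n) +
    (fun n => series a n * series b n) = series c.
  by apply/funext => n; rewrite /= fctE subrK.
exact.
Qed.

End ComplexSeries.

(** * Complex powers of integers and bounds for Dirichlet series *)

Section NatPow.
Context {R : realType}.
Local Open Scope complex_scope.
Implicit Types (s t z : R[i]) (m n : nat).

Lemma expCD z w : expC (z + w) = expC z * expC w :> R[i].
Proof.
case: z w => [x y] [x' y']; rewrite /expC /= expRD cosD sinD rmorphM mulrACA.
congr (_ * _); rewrite -[RHS]/(Complex _ _); congr Complex; ring.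
Qed.

Lemma normc_expC z : `|expC z| = (expR (complex.Re z))%:C.
Proof.
rewrite /expC normrM normc_def /= expr0n addr0 sqrtr_sqr ger0_norm ?expR_ge0 //.
by rewrite normc_def /= cos2Dsin2 sqrtr1 mulr1.
Qed.

Lemma norm_natpowC n s : (0 < n)%N ->
  `|natpowC n s| = (n%:R `^ complex.Re s)%:C.
Proof.
move=> n0; rewrite /natpowC normc_expC /powR pnatr_eq0 eqn0Ngt n0 /=.
by case: s => x y /=; rewrite mulr0 subr0.
Qed.

Lemma natpowCM m n s : (0 < m)%N -> (0 < n)%N ->
  natpowC (m * n) s = natpowC m s * natpowC n s.
Proof.
move=> m0 n0; rewrite /natpowC -expCD -mulrDr -rmorphD.
by rewrite natrM lnM // posrE ltr0n.
Qed.

Lemma natpowCD n s t : natpowC n (s + t) = natpowC n s * natpowC n t.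
Proof. by rewrite /natpowC -expCD -mulrDl. Qed.

Lemma natpowC1 n : (0 < n)%N -> natpowC n 1 = n%:R :> R[i].
Proof.
move=> n0; rewrite /natpowC mul1r /expC /= cos0 sin0 lnK ?posrE ?ltr0n //.
by rewrite mulr1 rmorph_nat.
Qed.

Lemma natpowC_sqr n s : (0 < n)%N -> natpowC (n ^ 2) s = natpowC n (2 * s).
Proof. by move=> n0; rewrite -mulnn natpowCM // -natpowCD mulr_natl mulr2n. Qed.

Lemma natpowC_subr1 n s : (0 < n)%N -> natpowC n s = natpowC n (s - 1) * n%:R.
Proof. by move=> n0; rewrite -(natpowC1 n n0) -natpowCD subrK. Qed.

Lemma norm_dirichlet_term (a : nat) n s : (0 < n)%N ->
  `|a%:R / natpowC n s| = (a%:R * n%:R `^ (- complex.Re s))%:C.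
Proof.
move=> n0; rewrite normrM normfV norm_natpowC // powRN rmorphM /= fmorphV.
by rewrite normr_nat rmorph_nat.
Qed.

(* The tail of the series telescopes: with [t = x - 1] and [l = ln (1 + 1 / n)],
   [n ^- t - (n+1) ^- t = (n+1) ^- t * (exp (t * l) - 1)], where
   [exp (t * l) - 1 >= t * l >= t / (n + 1)]. *)
Lemma powRN_telescope (t : R) n : 0 < t -> (0 < n)%N ->
  t * n.+1%:R `^ (- (1 + t)) <= n%:R `^ (- t) - n.+1%:R `^ (- t).
Proof.
move=> t0 n0.
have n0R : 0 < n%:R :> R by rewrite ltr0n.
have n1R : 0 < n.+1%:R :> R by rewrite ltr0n.
(* This is [exp (- l) >= 1 - l], with [exp (- l) = n / (n + 1) = 1 - 1 / (n + 1)]. *)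
have step : n.+1%:R^-1 <= ln (n.+1%:R : R) - ln n%:R.
  have := expR_ge1Dx (ln (n%:R : R) - ln n.+1%:R).
  rewrite -ln_div ?posrE // lnK ?posrE ?divr_gt0 // ln_div ?posrE //.
  have -> : n%:R / n.+1%:R = 1 - n.+1%:R^-1 :> R.
    by rewrite -[X in _ = X - _](divff (lt0r_neq0 n1R)) -[X in _ - X]mul1r
      -mulrBl -natr1 addrK.
  by rewrite lerD2l lerNr opprB.
have e : n%:R `^ (- t) = n.+1%:R `^ (- t) * expR (t * (ln (n.+1%:R : R) -
    ln n%:R)).
  by rewrite /powR !pnatr_eq0 !eqn0Ngt n0 /= -expRD; congr expR; ring.
rewrite e -[X in _ - X]mulr1 -mulrBr opprD powRD;
  last by rewrite pnatr_eq0 implybT.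
rewrite powR_inv1 ?ler0n // mulrA mulrC ler_wpM2l ?powR_ge0 //.
rewrite lerBrDl; apply: le_trans (expR_ge1Dx _).
by rewrite lerD2l ler_wpM2l // ltW.
Qed.

Lemma sum_powRN_le (x : R) N : 1 < x ->
  \sum_(n < N) n.+1%:R `^ (- x) <= 1 + (x - 1)^-1.
Proof.
move=> x1; have t0 : 0 < x - 1 by rewrite subr_gt0.
case: N => [|N]; first by rewrite big_ord0 addr_ge0 // invr_ge0 ltW.
(* Keeping the telescoped remainder makes the bound provable by induction. *)
suff : \sum_(n < N.+1) n.+1%:R `^ (- x) <=
    1 + (x - 1)^-1 * (1 - N.+1%:R `^ (- (x - 1))).
  move=> /le_trans; apply; rewrite lerD2l ler_piMr ?invr_ge0 ?(ltW t0) //.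
elim: N => [|N IH]; first by rewrite big_ord1 !powR1 subrr mulr0 addr0.
rewrite big_ord_recr /=; apply: le_trans (lerD IH (lexx _)) _.
have := powRN_telescope _ N.+1 t0 (ltn0Sn N).
rewrite addrCA subrr addr0 -ler_pdivlMl // =>
  /(lerD (lexx (1 + (x - 1)^-1 * (1 - N.+1%:R `^ (- (x - 1))))))/le_trans;
  apply.
by rewrite -addrA -mulrDr addrA subrK.
Qed.

(** Multiplicativity of [natpowC] splits each term. The sequence [a] is kept apart from [f] so that
    the first factor reads as a zeta series: at [s - 1] for [k = 1], [f = id], and at [2 * s] for
    [k = 2], [f = 1]. *)
Lemma cvgn_dirichlet_series_conv (k : nat) (f g h : nat -> nat) s
    (a : nat -> R[i]^o) (u : R^nat) (A B : R) :
  (forall N n, (0 < n <= N)%N -> h n = power_conv k f g N n) ->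
  (forall i, (f i.+1)%:R / natpowC (i.+1 ^ k) s = a i) ->
  (forall i, `|a i| = (u i)%:C) -> (forall N, \sum_(i < N) u i <= A) ->
  (forall N, \sum_(j < N) (g j.+1)%:R * j.+1%:R `^ (- complex.Re s) <= B) ->
  dirichlet_series h s @ \oo -->
    (limn (series a) * limn (dirichlet_series g s) : R[i]^o).
Proof.
move=> hE aE au uA gB.
apply: (@cvgn_power_conv _ k a _ _ _ _ _ _ _ au uA _ gB); last first.
  by move=> j; rewrite norm_dirichlet_term.
move=> N n nN; rewrite (hE N) // natr_sum mulr_suml; apply: eq_bigr => i _.
rewrite natr_sum mulr_suml; apply: eq_bigr => j /eqP <-.
by rewrite -aE natpowCM ?expn_gt0 // natrM invfM mulrACA.
Qed.

End NatPow.

(** * Convergence and the two product formulas *)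

Section Zeta.
Context {R : realType} (s : R[i]) (hs : 2 < complex.Re s).
Local Open Scope complex_scope.
Let x := complex.Re s.

Let x1 : 1 < x. Proof. by move: hs; rewrite -/x; lra. Qed.
Let x11 : 1 < x - 1. Proof. by move: hs; rewrite -/x; lra. Qed.

Lemma cvgn_zeta (z : R[i]) : 1 < complex.Re z ->
  cvgn (dirichlet_series (fun=> 1%N) z).
Proof.
move=> z1; apply: (@cvgn_complex_series _ _
  (fun n => n.+1%:R `^ (- complex.Re z)) (1 + (complex.Re z - 1)^-1)).
  by move=> n; rewrite norm_dirichlet_term // mul1r.
by move=> N; exact: sum_powRN_le.
Qed.

Lemma natr_powRN n : n.+1%:R * n.+1%:R `^ (- x) = n.+1%:R `^ (- (x - 1)) :> R.
Proof.
rewrite opprB powRD; last by rewrite pnatr_eq0 implybT.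
by rewrite powRr1 // ler0n.
Qed.

(** With nonnegative terms, the partial sums of the convolution of [id] and 1 stay below the product
    of those at [x - 1] and [x]. This bound also controls the series of [card_PF1]. *)
Lemma sum_coef_Z2_le N : \sum_(n < N) (coef_Z2 n.+1)%:R * n.+1%:R `^ (- x) <=
  (1 + (x - 1 - 1)^-1) * (1 + (x - 1)^-1) :> R.
Proof.
have cE M n : (n < M)%N -> (coef_Z2 n.+1)%:R * n.+1%:R `^ (- x) =
    \sum_(i < M) \sum_(j < M | (i.+1 ^ 1 * j.+1 == n.+1)%N)
     (i.+1%:R `^ (- (x - 1))) * (j.+1%:R `^ (- x)) :> R.
  move=> nM; rewrite (coef_Z2_sigma M) // natr_sum mulr_suml;
    apply: eq_bigr => i _.
  rewrite natr_sum mulr_suml; apply: eq_bigr => j /eqP <-.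
  by rewrite muln1 natrM powRM ?ler0n // mulrA natr_powRN.
rewrite (sum_power_conv _ (fun i => i.+1%:R `^ (- (x - 1)))
  (fun j => j.+1%:R `^ (- x)) _ cE).
apply: le_trans (_ : (\sum_(i < N) i.+1%:R `^ (- (x - 1))) *
  (\sum_(j < N) j.+1%:R `^ (- x)) <= _).
  rewrite big_distrlr /=; apply: ler_sum => i _; rewrite big_mkcond /=;
    apply: ler_sum => j _.
  by case: ifP => // _; rewrite mulr_ge0 ?powR_ge0.
by apply: ler_pM; rewrite ?sumr_ge0 ?sum_powRN_le // => *; rewrite powR_ge0.
Qed.

Lemma sum_card_PF1_le N : \sum_(n < N) (card_PF1 n.+1)%:R * n.+1%:R `^ (- x) <=
  (1 + (x - 1 - 1)^-1) * (1 + (x - 1)^-1) :> R.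
Proof.
apply: le_trans (sum_coef_Z2_le N); apply: ler_sum => n _.
by rewrite ler_wpM2r ?powR_ge0 // ler_nat leq_card_PF1_coef_Z2.
Qed.

Lemma cvgn_zeta_PF1 : cvgn (dirichlet_series card_PF1 s).
Proof.
apply: (@cvgn_complex_series _ _
  (fun n => (card_PF1 n.+1)%:R * n.+1%:R `^ (- x)));
    last exact: sum_card_PF1_le.
by move=> n; rewrite norm_dirichlet_term.
Qed.

Lemma cvgn_zeta_Z2_sigma :
  dirichlet_series coef_Z2 s @ \oo --> (zeta (s - 1) * zeta s : R[i]^o).
Proof.
apply: (@cvgn_dirichlet_series_conv _ 1 id (fun=> 1%N) coef_Z2 s _
    (fun n => n.+1%:R `^ (- (x - 1))) _ _ coef_Z2_sigma _ _
    (fun N => sum_powRN_le _ N x11)).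
- move=> i; rewrite expn1 (natpowC_subr1 i.+1) // invfM mulrCA divff
    ?pnatr_eq0 //.
  by rewrite mulr1 -[LHS]mul1r.
- by move=> i; rewrite norm_dirichlet_term // mul1r /x; case: (s).
- move=> N; under eq_bigr do rewrite mul1r; exact: sum_powRN_le.
Qed.

Lemma cvgn_zeta_Z2_PF1 :
  dirichlet_series coef_Z2 s @ \oo --> (zeta (2 * s) * zeta_PF1 s : R[i]^o).
Proof.
have x2 : 1 < 2 * x by move: x1; lra.
apply: (@cvgn_dirichlet_series_conv _ 2 (fun=> 1%N) (@card_PF1) coef_Z2 s _
    (fun n => n.+1%:R `^ (- (2 * x))) _ _ coef_Z2_conv _ _
    (fun N => sum_powRN_le _ N x2) sum_card_PF1_le).
- by move=> i; rewrite natpowC_sqr.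
- by move=> i; rewrite norm_dirichlet_term // mul1r !mulr_natl /x; case: (s).
Qed.

End Zeta.

Theorem corollary3p3 (R : realType) (s : R[i]) (hs : 2 < complex.Re s) :
  [/\ cvgn (dirichlet_series (fun=> 1%N) (s - 1)),
      cvgn (dirichlet_series (fun=> 1%N) s)
    & cvgn (dirichlet_series (fun=> 1%N) (2 * s))] /\
  (cvgn (dirichlet_series coef_Z2 s) /\ zeta_Z2 s = zeta (s - 1) * zeta s) /\
  (cvgn (dirichlet_series card_PF1 s) /\
   zeta_Z2 s = zeta (2 * s) * zeta_PF1 s).
Proof.
have h1 := cvgn_zeta_Z2_sigma s hs.
have h2 := cvgn_zeta_Z2_PF1 s hs.
split; first split.
- by apply: cvgn_zeta; case: (s) hs => y z /=; lra.
- by apply: cvgn_zeta; lra.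
- apply: cvgn_zeta; rewrite mulr_natl; case: (s) hs => y z /=. lra.
split; split.
- exact: cvgP h1.
- exact: (cvg_lim (@norm_hausdorff _ (R[i]^o)) h1).
- exact: cvgn_zeta_PF1.
- exact: (cvg_lim (@norm_hausdorff _ (R[i]^o)) h2).
Qed.
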